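(* Let $M\subseteq\mathbb{Z}^q_{\geq0}$ be an affine monoid. If $M$ is normal, then $\operatorname{mpt}(M)\in\mathbb{Q}_{>0}$.
   Context: An affine monoid $M\subseteq\mathbb{Z}^q_{\geq 0}$ ($q$ a positive integer) is a finitely generated submonoid of $\mathbb{Z}^q$ contained in $\mathbb{Z}^q_{\geq0}$. $\mathbb{Z}M$ is the group generated by $M$, and $C(M)=\mathbb{R}_{\geq0}M$ is the cone generated by $M$; $M$ is normal if $C(M)\cap\mathbb{Z}M=M$. For $\alpha\in\mathbb{Q}^q$, $|\alpha|$ is the sum of its coordinates. For an integer $m>1$, $\frac1mM=\{\gamma/m:\gamma\in M\}$ and $$V_m(M)=\left\{\alpha\in\tfrac1mM \;\middle|\; \left(\tfrac1mM-\alpha\right)\cap\mathbb{Z}M\subseteq M\right\},\qquad V(M)=\bigcup_{m>1}V_m(M).$$ The pure threshold of $M$ is $\operatorname{mpt}(M)=\sup\{|\alpha|: \alpha\in V(M)\}$ (and $-\infty$ if $V(M)=\emptyset$).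
   Formalization: The formal theorem assumes M ≠ {0}: the trivial monoid M = {0} is affine and normal, but V(M) = {0} and mpt(M) = 0, so the claim mpt(M) > 0 fails there; this is the only case excluded. *)

(* Defs.v *)
From HB Require Import structures.
From mathcomp Require Import all_boot all_order all_algebra.
From mathcomp Require Import all_classical all_reals ereal.

Import Order.TTheory GRing.Theory Num.Theory.
Local Open Scope classical_set_scope.
Local Open Scope ring_scope.

(* Subsets of Z^q are [set 'rV[int]_q]; they are compared with subsets of Q^q
   and R^q through the entrywise embedding. *)
Definition of_int (K : pzRingType) {q : nat} (v : 'rV[int]_q) : 'rV[K]_q :=
  map_mx intr v.

Definition submonoid {q : nat} (A : set 'rV[int]_q) : Prop :=
  Algebra.nmod_closed (mem A).

Definition subgroup {q : nat} (A : set 'rV[int]_q) : Prop :=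
  Algebra.zmod_closed (mem A).

Definition affine_monoid {q : nat} (M : set 'rV[int]_q) : Prop :=
  [/\ submonoid M,
      exists s : seq 'rV[int]_q, M = smallest (@submonoid q) [set` s]
    & forall v, M v -> forall i, 0 <= v 0 i].

(* ZM *)
Definition group_gen {q : nat} (M : set 'rV[int]_q) : set 'rV[int]_q :=
  smallest (@subgroup q) M.

(* C(M): finite nonnegative real combinations of elements of M. *)
Definition cone (R : realType) {q : nat} (M : set 'rV[int]_q) :
    set 'rV[R]_q :=
  [set x | exists (n : nat) (c : 'I_n -> R) (v : 'I_n -> 'rV[int]_q),
     [/\ forall i, 0 <= c i, forall i, M (v i)
       & x = \sum_(i < n) c i *: of_int R (v i)]].

Definition normal_monoid (R : realType) {q : nat} (M : set 'rV[int]_q) : Prop :=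
  (of_int R @^-1` cone R M) `&` group_gen M = M.

(* (1/m) M *)
Definition frac_monoid {q : nat} (m : nat) (M : set 'rV[int]_q) : set 'rV[rat]_q :=
  [set m%:R^-1 *: of_int rat u | u in M].

(* V_m(M) *)
Definition Vm {q : nat} (m : nat) (M : set 'rV[int]_q) : set 'rV[rat]_q :=
  [set a | frac_monoid m M a /\
     [set b - a | b in frac_monoid m M] `&` (of_int rat @` group_gen M)
       `<=` of_int rat @` M].

(* V(M) *)
Definition Vset {q : nat} (M : set 'rV[int]_q) : set 'rV[rat]_q :=
  \bigcup_(m in [set m : nat | (1 < m)%N]) Vm m M.

Definition coord_sum {q : nat} (a : 'rV[rat]_q) : rat := \sum_i a 0 i.

(* The pure threshold; [ereal_sup set0] is -oo. *)
Definition mpt (R : realType) {q : nat} (M : set 'rV[int]_q) : \bar R :=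
  ereal_sup [set (ratr (coord_sum a) : R)%:E | a in Vset M].

(* Main.v *)
Require Import Defs.
From mathcomp Require Import all_boot all_order all_algebra.
From mathcomp Require Import all_classical all_reals ereal.
From mathcomp Require Import ring lra zify.

(* The cone of M is cut out in ZM by finitely many integer functionals (Weyl);
   for an irredundant system, let d(l) be the least positive value of l on ZM.
   Then V_m(M) consists of the points a of (1/m) M with l(a) < d(l) for all l:
   otherwise some w in ZM \ M with l(w) = - d(l) has a + w in the cone, and
   conversely l(w) > - d(l) forces l(w) >= 0. So mpt(M) is the maximum of the
   coordinate sum over the polytope l <= d(l) of the cone, a linear program with
   rational data; strictness is harmless since t x is in V(M) for rational t < 1
   and x an optimal point. Everything takes place over Q: normality only
   matters for the rational points of the real cone. *)

Import Order.TTheory GRing.Theory Num.Theory.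
Local Open Scope classical_set_scope.
Local Open Scope ring_scope.

(** * The standard bilinear pairing *)

Section Dot.
Set Implicit Arguments.
Unset Strict Implicit.
Variables (K : comPzRingType) (n : nat).
Implicit Types (l x y : 'rV[K]_n) (a : K).

Definition dot l x : K := \sum_i l 0 i * x 0 i.

Lemma dotC l x : dot l x = dot x l.
Proof. by apply: eq_bigr => i _; rewrite mulrC. Qed.

Lemma dotDr l x y : dot l (x + y) = dot l x + dot l y.
Proof. by rewrite -big_split; apply: eq_bigr => i _; rewrite mxE mulrDr. Qed.

Lemma dotZr l a x : dot l (a *: x) = a * dot l x.
Proof. by rewrite mulr_sumr; apply: eq_bigr => i _; rewrite mxE mulrCA. Qed.

Lemma dotDl l x y : dot (x + y) l = dot x l + dot y l.
Proof. by rewrite dotC dotDr !(dotC l). Qed.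

Lemma dotZl l a x : dot (a *: x) l = a * dot x l.
Proof. by rewrite dotC dotZr dotC. Qed.

Lemma dotNr l x : dot l (- x) = - dot l x.
Proof. by rewrite -scaleN1r dotZr mulN1r. Qed.

Lemma dotNl l x : dot (- x) l = - dot x l.
Proof. by rewrite dotC dotNr dotC. Qed.

Lemma dotBr l x y : dot l (x - y) = dot l x - dot l y.
Proof. by rewrite dotDr dotNr. Qed.

Lemma dot0r l : dot l 0 = 0.
Proof. by rewrite -(scale0r 0) dotZr mul0r. Qed.

Lemma dotMnr l x k : dot l (x *+ k) = dot l x *+ k.
Proof. by elim: k => [|k IH]; rewrite ?mulr0n ?dot0r// !mulrS dotDr IH. Qed.

Lemma dot_sumr l (I : Type) (r : seq I) (f : I -> 'rV[K]_n) :
  dot l (\sum_(i <- r) f i) = \sum_(i <- r) dot l (f i).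
Proof.
by elim: r => [|i r IH]; rewrite ?big_nil ?dot0r// !big_cons dotDr IH.
Qed.

Lemma dot_suml l (I : Type) (r : seq I) (f : I -> 'rV[K]_n) :
  dot (\sum_(i <- r) f i) l = \sum_(i <- r) dot (f i) l.
Proof. by rewrite dotC dot_sumr; apply: eq_bigr => i _; rewrite dotC. Qed.

Lemma dot_deltal i x : dot (delta_mx 0 i) x = x 0 i.
Proof.
rewrite /dot (bigD1 i)//= !mxE !eqxx mul1r big1 ?addr0// => j ne_ji.
by rewrite mxE (negPf ne_ji) andbF mul0r.
Qed.

End Dot.

(** * Finitely generated cones over an ordered field, and Weyl's theorem *)

Section Cone.
Set Implicit Arguments.
Unset Strict Implicit.
Variable F : realFieldType.

Lemma seq_argmin (T : eqType) (f : T -> F) (s : seq T) : s != [::] ->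
  exists2 x, x \in s & {in s, forall y, f x <= f y}.
Proof.
elim: s => // a [|b s] IH _.
  by exists a => [|y]; rewrite inE// => /eqP->.
have [//|x xs xmin] := IH.
have [le_ax|lt_xa] := leP (f a) (f x).
  exists a; rewrite ?mem_head// => y; rewrite inE => /predU1P[->//|/xmin].
  exact: le_trans.
exists x; first by rewrite inE xs orbT.
by move=> y; rewrite inE => /predU1P[->|/xmin//]; exact: ltW.
Qed.

Lemma seq_separation (A B : seq F) :
  {in A & B, forall a b, a <= b} ->
  exists c, {in A, forall a, a <= c} /\ {in B, forall b, c <= b}.
Proof.
have [-> _|A0 AB] := eqVneq A [::].
  have [->|B0] := eqVneq B [::]; first by exists 0.
  by have [c _ cB] := seq_argmin id B0; exists c.
have [c cA cmax] := seq_argmin -%R A0.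
by exists c; split=> [a /cmax|b]; [rewrite lerN2|exact: AB].
Qed.

(** A pair [p] is an affine constraint on [c]: a lower bound if [p.2] is positive, an upper bound if
    it is negative. A solution exists when each lower bound is at most each upper bound; the
    inequality between them is stated cleared of denominators. *)
Lemma fourier_motzkin (s : seq (F * F)) :
  (exists c, {in s, forall p, 0 <= p.1 + c * p.2}) <->
  {in s, forall p, p.2 = 0 -> 0 <= p.1} /\
  {in s &, forall p r, 0 < p.2 -> r.2 < 0 -> 0 <= p.2 * r.1 - r.2 * p.1}.
Proof.
split=> [[c cs]|[s0 spn]].
  split=> [p ps p0|p r ps rs p0 r0].
    by have := cs _ ps; rewrite p0 mulr0 addr0.
  have -> : p.2 * r.1 - r.2 * p.1 =
    p.2 * (r.1 + c * r.2) + - r.2 * (p.1 + c * p.2) by ring.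
  by rewrite addr_ge0// mulr_ge0 ?cs// ?oppr_ge0 ltW.
have [|c [cA cB]] := @seq_separation
    [seq - p.1 / p.2 | p <- s & 0 < p.2] [seq - p.1 / p.2 | p <- s & p.2 < 0].
  move=> _ _ /mapP[p + ->] /mapP[r + ->].
  rewrite !mem_filter => /andP[p0 ps] /andP[r0 rs].
  rewrite ler_pdivrMr// mulrAC ler_ndivlMr//.
  by have := spn _ _ ps rs p0 r0; lra.
exists c => p ps; have [p0|p0|p0] := ltgtP p.2 0.
- have /cB : - p.1 / p.2 \in [seq - p.1 / p.2 | p <- s & p.2 < 0].
    by apply/mapP; exists p; rewrite // mem_filter p0.
  by rewrite ler_ndivlMr//; lra.
- have /cA : - p.1 / p.2 \in [seq - p.1 / p.2 | p <- s & 0 < p.2].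
    by apply/mapP; exists p; rewrite // mem_filter p0.
  by rewrite ler_pdivrMr//; lra.
- by rewrite p0 mulr0 addr0 s0.
Qed.

Variable n : nat.
Implicit Types (s : seq 'rV[F]_n) (x y g l : 'rV[F]_n).

(** The recursion exposes one scalar per generator, which is the shape needed to eliminate variables
    one at a time. *)
Fixpoint cone_of s x : Prop :=
  if s is g :: s' then exists2 c, 0 <= c & cone_of s' (x - c *: g) else x = 0.

Lemma cone_of0 s : cone_of s 0.
Proof. by elim: s => //= g s IH; exists 0; rewrite // scale0r subr0. Qed.

Lemma cone_ofD s x y : cone_of s x -> cone_of s y -> cone_of s (x + y).
Proof.
elim: s x y => [x y -> ->|g s IH x y] /=; first by rewrite addr0.
move=> [c c0 xs] [d d0 ys]; exists (c + d); first exact: addr_ge0.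
by rewrite scalerDl opprD addrACA; exact: IH.
Qed.

Lemma cone_ofZ s a x : 0 <= a -> cone_of s x -> cone_of s (a *: x).
Proof.
move=> a0; elim: s x => [x ->|g s IH x] /=; first by rewrite scaler0.
move=> [c c0 xs]; exists (a * c); first exact: mulr_ge0.
by rewrite -scalerA -scalerBr; exact: IH.
Qed.

Lemma mem_cone_of s g : g \in s -> cone_of s g.
Proof.
elim: s => //= h s IH; rewrite inE => /predU1P[->|/IH gs].
  by exists 1; rewrite // scale1r subrr; exact: cone_of0.
by exists 0; rewrite // scale0r subr0.
Qed.

Lemma cone_of_ge0 s l x : {in s, forall g, 0 <= dot l g} ->
  cone_of s x -> 0 <= dot l x.
Proof.
elim: s x => [x _ ->|g s IH x ls] /=; first by rewrite dot0r.
case=> c c0 /IH; rewrite dotBr dotZr => H.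
have : 0 <= dot l x - c * dot l g.
  by apply: H => h hs; rewrite ls// inE hs orbT.
by rewrite subr_ge0; apply: le_trans; rewrite mulr_ge0// ls// mem_head.
Qed.

Lemma cone_of_cat s1 s2 x : cone_of (s1 ++ s2) x <->
  exists y z, [/\ cone_of s1 y, cone_of s2 z & x = y + z].
Proof.
elim: s1 x => [x|g s IH x] /=.
  split=> [xs|[_ [z [-> zs ->]]]]; last by rewrite add0r.
  by exists 0, x; rewrite add0r.
split=> [[c c0 /IH[y [z [ys zs e]]]]|[y [z [[c c0 ys] zs ->]]]].
  exists (y + c *: g), z; split=> //; first by exists c; rewrite // addrK.
  by rewrite addrAC -e subrK.
by exists c => //; apply/IH; exists (y - c *: g), z; rewrite addrAC.
Qed.

(* Weyl: adjoining a generator g adds one variable c >= 0 with x - c g in the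
   previous cone, which is then eliminated. *)
Lemma cone_of_halfspaces s : exists L : seq 'rV[F]_n,
  forall x, cone_of s x <-> {in L, forall l, 0 <= dot l x}.
Proof.
elim: s => [|g s [L IH]] /=.
  exists ([seq delta_mx 0 i | i <- enum 'I_n] ++
          [seq - delta_mx 0 i | i <- enum 'I_n]) => x; split=> [-> l _|xL].
    by rewrite dot0r.
  apply/rowP => i; rewrite mxE; apply/eqP; rewrite eq_le; apply/andP; split.
    rewrite -oppr_ge0 -dot_deltal -dotNl; apply: xL.
    rewrite mem_cat; apply/orP; right.
    by apply/mapP; exists i; rewrite ?mem_enum.
  rewrite -dot_deltal; apply: xL; rewrite mem_cat; apply/orP; left.
  by apply/mapP; exists i; rewrite ?mem_enum.
(* Functionals nonnegative on [g] survive; each pair of opposite signs on [g] is replaced by its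
   positive combination that vanishes on [g]. *)
exists ([seq l <- L | 0 <= dot l g] ++
  [seq (- dot l g) *: m + dot m g *: l |
    l <- [seq l <- L | dot l g < 0], m <- [seq l <- L | 0 < dot l g]]) => x.
(* The pair [(0, 1)] encodes [0 <= c], and the others encode [0 <= dot l (x - c *: g)]. *)
pose t := (0, 1) :: [seq (dot l x, - dot l g) | l <- L].
have tP l : l \in L -> (dot l x, - dot l g) \in t.
  by move=> lL; apply: mem_behead; apply: map_f lL.
have -> : (exists2 c, 0 <= c & cone_of s (x - c *: g)) <->
    (exists c, {in t, forall p, 0 <= p.1 + c * p.2}).
  split=> [[c c0 /IH H]|[c H]]; exists c.
  - move=> p; rewrite inE => /predU1P[->|/mapP[l lL ->]] /=.
      by rewrite mulr1 add0r.
    by rewrite mulrN -dotZr -dotBr H.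
  - by have := H _ (mem_head _ _); rewrite /= mulr1 add0r.
  - by apply/IH => l lL; rewrite dotBr dotZr -mulrN; exact: H _ (tP _ lL).
rewrite fourier_motzkin; split=> [[H0 H]|H].
  move=> l; rewrite mem_cat mem_filter => /orP[/andP[+ lL]|/allpairsP[[l' m]]].
    rewrite le_eqVlt => /predU1P[lg|lg].
      by apply: (H0 _ (tP _ lL)); rewrite /= -lg oppr0.
    have := H _ _ (mem_head _ _) (tP _ lL).
    by rewrite /= mul1r mulr0 subr0 oppr_lt0; apply.
  rewrite /= !mem_filter => -[/andP[l'g l'L] /andP[mg mL] ->].
  rewrite dotDl !dotZl.
  have := H _ _ (tP _ l'L) (tP _ mL); rewrite /= oppr_gt0 oppr_lt0 mulNr.
  by rewrite [- dot m g * _]mulNr opprK; exact.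
have H1 l : l \in L -> 0 <= dot l g -> 0 <= dot l x.
  by move=> lL lg; apply: H; rewrite mem_cat mem_filter lg lL.
split=> [p|p r]; rewrite ?inE.
  case/predU1P=> [->//|/mapP[l lL -> /= /eqP]]; rewrite oppr_eq0 => /eqP lg.
  by rewrite H1// lg.
move=> /predU1P[->|/mapP[l lL ->]] /predU1P[->|/mapP[m mL ->]] /=.
- by rewrite ltr10.
- by rewrite mul1r mulr0 subr0 oppr_lt0 => _ /ltW; exact: H1.
- by rewrite ltr10.
rewrite oppr_gt0 oppr_lt0 => lg mg; rewrite [- dot m g * _]mulNr opprK.
rewrite -!dotZl -dotDl; apply: H; rewrite mem_cat; apply/orP; right.
by apply/allpairsP; exists (l, m); rewrite !mem_filter lg mg lL mL.
Qed.

Lemma cone_of_sum s (I : Type) (r : seq I) (f : I -> 'rV[F]_n) :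
  (forall i, cone_of s (f i)) -> cone_of s (\sum_(i <- r) f i).
Proof.
by move=> H; apply: big_rec => [|i x _]; [exact: cone_of0|exact: cone_ofD].
Qed.

Lemma cone_of_delta x :
  cone_of [seq delta_mx 0 i | i <- enum 'I_n] x <-> forall i, 0 <= x 0 i.
Proof.
split=> [xs i|x0].
  rewrite -dot_deltal; apply: cone_of_ge0 xs => _ /mapP[j _ ->].
  by rewrite dot_deltal mxE ler0n.
rewrite [x]row_sum_delta; apply: cone_of_sum => i; apply: cone_ofZ => //.
by apply: mem_cone_of; apply/mapP; exists i; rewrite ?mem_enum.
Qed.

End Cone.

(** * Linear programs over an ordered field: a bounded program attains its maximum *)

Section LinearProgramming.
Set Implicit Arguments.
Unset Strict Implicit.
Variables (F : realFieldType) (n : nat).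
Implicit Types (s : seq 'rV[F]_n) (x y g l : 'rV[F]_n).

Lemma cone_of_map k (phi : {linear 'rV[F]_n -> 'rV[F]_k}) s
    (y : 'rV[F]_k) :
  cone_of (map phi s) y <-> exists2 x, cone_of s x & y = phi x.
Proof.
elim: s y => [|g s IH] y /=.
  by split=> [->|[x -> ->]]; [exists 0|]; rewrite ?linear0.
split=> [[c c0 /IH[x xs e]]|[x [c c0 xs] ->]].
  exists (x + c *: g); first by exists c; rewrite // addrK.
  by rewrite linearD linearZ/= -e subrK.
exists c => //; apply/IH; exists (x - c *: g) => //.
by rewrite linearB [phi (c *: g)]linearZ.
Qed.

(* The points z dominating A x for some x of the cone form a finitely generated
   cone, to which Weyl's theorem applies. *)
Lemma dominated_halfspaces s k (A : 'M[F]_(n, k)) : exists P : seq 'rV[F]_k,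
  forall z : 'rV[F]_k,
    (exists2 x, cone_of s x & forall i, (x *m A) 0 i <= z 0 i) <->
    {in P, forall p, 0 <= dot p z}.
Proof.
have [P HP] := cone_of_halfspaces
  (map (mulmxr A) s ++ [seq delta_mx 0 i | i <- enum 'I_k]).
exists P => z; rewrite -HP cone_of_cat; split=> [[x xs xz]|[y [w []]]].
  exists (x *m A), (z - x *m A); split; last by rewrite addrC subrK.
    by apply/cone_of_map; exists x.
  by apply/cone_of_delta => i; rewrite !mxE subr_ge0; have := xz i; rewrite mxE.
move=> /cone_of_map[x xs ->] /cone_of_delta w0 ->; exists x => // i.
by rewrite !mxE lerDl.
Qed.

(** By projection to the objective, the values [t] reached or exceeded by feasible points are cut
    out by finitely many affine inequalities, so the least upper bound among these is attained.
    Nonnegativity of [d] makes 0 feasible. *)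
Lemma linear_program_max s (T : eqType) (L : seq T)
    (b : 'rV[F]_n) (h : T -> 'rV[F]_n) (d : T -> F) K :
  {in L, forall l : T, 0 <= d l} ->
  (forall x, cone_of s x -> {in L, forall l : T, dot (h l) x <= d l} ->
    dot b x <= K) ->
  exists x, [/\ cone_of s x, {in L, forall l : T, dot (h l) x <= d l} &
    forall y, cone_of s y -> {in L, forall l : T, dot (h l) y <= d l} ->
      dot b y <= dot b x].
Proof.
move=> d0 bK; pose k := size L.
(* Column 0 encodes [t <= dot b x] as [- dot b x <= - t]; the remaining columns are the
   constraints. *)
pose A : 'M[F]_(n, k.+1) := \matrix_(i, j) (- b :: map h L)`_j 0 i.
pose z t : 'rV[F]_k.+1 := \row_j (- t :: map d L)`_j.
have AE x j : (x *m A) 0 j = dot (- b :: map h L)`_j x.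
  by rewrite mxE; apply: eq_bigr => i _; rewrite mxE mulrC.
have [P HP] := dominated_halfspaces s A.
have {}HP t : (exists x,
    [/\ cone_of s x, {in L, forall l : T, dot (h l) x <= d l} &
    t <= dot b x]) <-> {in P, forall p, 0 <= dot p (z t)}.
  rewrite -HP; split=> [[x [xs xL tx]]|[x xs H]]; exists x => //.
    move=> [[|j] jk]; rewrite AE mxE /=; first by rewrite dotNl lerN2.
    have [l0 _] : exists l0 : T, l0 \in L.
      move: jk; rewrite /k; case: (L) => // l0 ? _.
      by exists l0; exact: mem_head.
    by rewrite !(nth_map l0)// xL// mem_nth.
  split=> // [l lL|].
    have lk : (index l L < k)%N by rewrite index_mem.
    have := H (lift ord0 (Ordinal lk)); rewrite AE mxE /=.
    by rewrite !(nth_map l)// nth_index.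
  by have := H ord0; rewrite AE mxE /= dotNl lerN2.
have zE t p : dot p (z t) = dot p (z 0) - t * p 0 0.
  have -> : z t = z 0 - t *: delta_mx 0 0.
    apply/rowP => -[[|j] jk]; rewrite !mxE/= ?oppr0 ?mulr1 ?add0r//.
    by rewrite mulr0 subr0.
  by rewrite dotBr dotZr [dot p (delta_mx 0 0)]dotC dot_deltal.
have P0 : {in P, forall p, 0 <= dot p (z 0)}.
  by apply/HP; exists 0; rewrite dot0r; split=> // [|l /d0]; rewrite ?dot0r//;
    exact: cone_of0.
have Pneg t : t <= 0 -> {in P, forall p, 0 <= dot p (z t)}.
  move=> t0; apply/HP; exists 0; rewrite dot0r; split=> // [|l /d0].
    exact: cone_of0.
  by rewrite dot0r.
(* Every [t <= 0] is reached at 0, so no [p] can bound [t] from below; the [t] chosen here would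
   give [dot p (z t) = -1]. *)
have p0 : {in P, forall p : 'rV_k.+1, 0 <= p 0 0}.
  move=> p pP; rewrite leNgt; apply/negP => p0.
  pose t := (dot p (z 0) + 1) / p 0 0.
  have t0 : t <= 0 by rewrite /t ler_ndivrMr// mul0r addr_ge0 ?P0.
  have := Pneg t t0 p pP; rewrite zE /t divfK ?lt_eqF//.
  by rewrite opprD addrA subrr sub0r oppr_ge0 ler10.
(* These are the genuine upper bounds on [t]. If there were none, the value [K + 1] would be
   reached; otherwise the smallest ratio is the optimum. *)
pose Q := [seq p : 'rV_k.+1 <- P | 0 < p 0 0].
have [Q0|Q0] := eqVneq Q [::].
  have /HP[x [xs xL]] : {in P, forall p, 0 <= dot p (z (K + 1))}.
    move=> p pP; rewrite zE.
    have : p \notin Q by rewrite Q0.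
    rewrite mem_filter pP andbT -leNgt => pn.
    have -> : p 0 0 = 0 by apply/eqP; rewrite eq_le pn p0.
    by rewrite mulr0 subr0 P0.
  by move=> /le_trans/(_ (bK _ xs xL)); rewrite gerDl ler10.
have [p + pmin] := seq_argmin (fun p : 'rV_k.+1 => dot p (z 0) / p 0 0) Q0.
rewrite mem_filter => /andP[pgt pP].
have /HP[x [xs xL xp]] : {in P, forall r, 0 <= dot r (z (dot p (z 0) / p 0 0))}.
  move=> r rP; rewrite zE subr_ge0.
  have := p0 _ rP; rewrite le_eqVlt => /predU1P[<-|r0].
    by rewrite mulr0 P0.
  by rewrite -ler_pdivlMr// pmin// mem_filter r0.
exists x; split=> // y ys yL; apply: le_trans xp.
have : {in P, forall r, 0 <= dot r (z (dot b y))} by apply/HP; exists y.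
by move=> /(_ p pP); rewrite zE subr_ge0 ler_pdivlMr.
Qed.

End LinearProgramming.

(** * Integral functionals on the group generated by a monoid *)

Section Lattice.
Set Implicit Arguments.
Unset Strict Implicit.
Variable q : nat.
Implicit Types (M : set 'rV[int]_q) (x y l : 'rV[int]_q).

Lemma submonoidP M :
  submonoid M <-> M 0 /\ forall x y, M x -> M y -> M (x + y).
Proof.
split=> [[M0 MD]|[M0 MD]]; split.
- by move: M0; rewrite inE.
- by move=> x y Mx My; have := MD x y; rewrite !inE; apply.
- by rewrite inE.
- by move=> x y; rewrite !inE; exact: MD.
Qed.

Lemma subgroupP M :
  subgroup M <-> M 0 /\ forall x y, M x -> M y -> M (x - y).
Proof.
split=> [[M0 MD]|[M0 MD]]; split.
- by move: M0; rewrite inE.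
- by move=> x y Mx My; have := MD x y; rewrite !inE; apply.
- by rewrite inE.
- by move=> x y; rewrite !inE; exact: MD.
Qed.

Lemma sub_group_gen M : M `<=` group_gen M.
Proof. exact: sub_gen_smallest. Qed.

Lemma group_gen0 M : group_gen M 0.
Proof. by move=> A [/subgroupP[]]. Qed.

Lemma group_genB M x y : group_gen M x -> group_gen M y -> group_gen M (x - y).
Proof.
move=> Mx My A [Asub MA]; have [_ AB] := (subgroupP A).1 Asub.
by apply: AB; [exact: Mx|exact: My].
Qed.

Lemma group_genN M x : group_gen M x -> group_gen M (- x).
Proof. by rewrite -sub0r; apply: group_genB; exact: group_gen0. Qed.

Lemma group_genD M x y : group_gen M x -> group_gen M y -> group_gen M (x + y).
Proof.
by move=> Mx My; rewrite -[y]opprK; apply: group_genB => //; exact: group_genN.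
Qed.

Lemma group_genMn M x k : group_gen M x -> group_gen M (x *+ k).
Proof.
move=> Mx; elim: k => [|k IH]; first exact: group_gen0.
by rewrite mulrS; exact: group_genD.
Qed.

Lemma submonoidMn M x k : submonoid M -> M x -> M (x *+ k).
Proof.
move=> /submonoidP[M0 MD] Mx; elim: k => [//|k IH].
by rewrite mulrS; exact: MD.
Qed.

Lemma dot_group_gen_eq0 M l : (forall x, M x -> dot l x = 0) ->
  forall x, group_gen M x -> dot l x = 0.
Proof.
move=> lM; apply: smallest_sub => //.
by apply/subgroupP; split=> [|x y /= lx ly]; rewrite ?dot0r// dotBr lx ly subrr.
Qed.

(** The converse, nonnegativity of [L] on [M], is kept apart: it passes to sublists for free,
    whereas this inclusion may be lost. *)
Definition cuts_out M (L : seq 'rV[int]_q) : Prop :=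
  forall x, group_gen M x -> {in L, forall l, 0 <= dot l x} -> M x.

(** Redundant functionals are dropped until none is left, by induction on the length. Filtering
    removes all copies of [l], so repetitions cannot hide redundancy. *)
Lemma irredundant_subseq M (L : seq 'rV[int]_q) : cuts_out M L ->
  exists2 L', {subset L' <= L} & cuts_out M L' /\
    {in L', forall l, ~ cuts_out M [seq m <- L' | m != l]}.
Proof.
have [n] := ubnP (size L); elim: n L => // n IH L; rewrite ltnS => Ln LM.
have [[l lL lM]|noL] :=
    pselect (exists2 l, l \in L & cuts_out M [seq m <- L | m != l]).
  have [|L' sub H] := IH _ _ lM.
    apply: leq_trans Ln; rewrite size_filter -(count_predC (pred1 l)).
    rewrite -[X in (X < _)%N]add0n ltn_add2r.
    by rewrite -has_count has_pred1.
  by exists L' => // m /sub; rewrite mem_filter => /andP[].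
by exists L => //; split=> // l lL lM; apply: noL; exists l.
Qed.

(** The values of [l] on the group are closed under negation, so some value is negative;
    well-ordering provides the one closest to 0. *)
Lemma min_positive_value M l w : group_gen M w -> 0 < dot l w ->
  exists d, [/\ 0 < d, exists2 v, group_gen M v & dot l v = - d &
    forall x, group_gen M x -> dot l x < 0 -> dot l x <= - d].
Proof.
move=> Mw w0.
pose p n := `[< exists2 v, group_gen M v & (0 < n)%N /\ dot l v = - n%:Z >].
have negP x : group_gen M x -> dot l x < 0 -> p `|dot l x|%N.
  move=> Mx x0; apply/asboolP; exists x => //; split; last by lia.
  by rewrite absz_gt0 lt_eqF.
have ex_p : exists n, p n.
  exists `|dot l (- w)|%N; apply: negP; first exact: group_genN.
  by rewrite dotNr oppr_lt0.
have [n /asboolP[v Mv [n0 vn]] nmin] := ex_minnP ex_p.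
exists n%:Z; split=> //; first by exists v.
by move=> x Mx x0; have := nmin _ (negP x Mx x0); lia.
Qed.

(* The functionals below are the facets: irredundance yields, for each l, a
   lattice point y with l(y) = 0 and all other functionals positive; adding
   multiples of y corrects a point v with l(v) = - d. *)
Lemma facet_functionals M (L0 : seq 'rV[int]_q) : submonoid M ->
  {in L0, forall l x, M x -> 0 <= dot l x} -> cuts_out M L0 ->
  exists (L : seq 'rV[int]_q) (d : 'rV[int]_q -> int),
    [/\ {in L, forall l x, M x -> 0 <= dot l x}, cuts_out M L,
        {in L, forall l, 0 < d l},
        {in L, forall l x, group_gen M x -> dot l x < 0 -> dot l x <= - d l} &
        {in L, forall l, exists w, [/\ group_gen M w, dot l w = - d l &
           {in L, forall m, m != l -> 0 <= dot m w}]}].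
Proof.
move=> Mmon L0M /irredundant_subseq[L sub [LM Lirr]].
have {sub}LM0 : {in L, forall l x, M x -> 0 <= dot l x}.
  by move=> l /sub; exact: L0M.
(* Without [l] the list admits a point outside [M], which only [l] can exclude. *)
have neg l : l \in L -> exists x, [/\ group_gen M x, dot l x < 0 &
    {in L, forall m, m != l -> 0 <= dot m x}].
  move=> lL; apply: contrapT => H; apply: (Lirr _ lL) => x Mx xL.
  have {}xL m : m \in L -> m != l -> 0 <= dot m x.
    by move=> mL ml; apply: xL; rewrite mem_filter ml mL.
  apply: LM => // m mL; have [->|/xL->//] := eqVneq m l.
  by rewrite leNgt; apply/negP => xl; apply: H; exists x.
(* Otherwise [l] would vanish on [M], hence on the whole group, against [neg]. *)
have pos l : l \in L -> exists2 x, M x & 0 < dot l x.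
  move=> lL; apply: contrapT => H.
  have [x [Mx + _]] := neg l lL; rewrite (@dot_group_gen_eq0 M)// => y My.
  apply/eqP; rewrite eq_le LM0// andbT leNgt; apply/negP => y0.
  by apply: H; exists y.
(* An interior point: the sum over [l] of elements of [M] on which [l] is positive. *)
have [c Mc cL] : exists2 c, M c & {in L, forall l, 0 < dot l c}.
  have [f fP] : exists f : 'rV[int]_q -> 'rV[int]_q,
      forall l, l \in L -> M (f l) /\ 0 < dot l (f l).
    have /choice[f fP] : forall l, exists x, l \in L -> M x /\ 0 < dot l x.
      move=> l; have [lL|_] := boolP (l \in L); last by exists 0.
      by have [x Mx lx] := pos l lL; exists x.
    by exists f.
  have [M0 MD] := (submonoidP M).1 Mmon.
  exists (\sum_(l <- L) f l).
    by rewrite big_seq; apply: big_ind => // l /fP[].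
  move=> l lL; rewrite dot_sumr (big_rem l)//= ltr_wpDr//; last first.
    by case: (fP l lL).
  rewrite big_seq; apply: sumr_ge0 => m /mem_rem mL.
  by apply: LM0 => //; case: (fP m mL).
have /choice[d dP] : forall l, exists d, l \in L ->
    [/\ 0 < d, exists2 v, group_gen M v & dot l v = - d &
    forall x, group_gen M x -> dot l x < 0 -> dot l x <= - d].
  move=> l; have [lL|_] := boolP (l \in L); last by exists 0.
  have [d dl] := min_positive_value (sub_group_gen Mc) (cL l lL).
  by exists d.
exists L, d; split=> // [l /dP[]//|l /dP[]//|l lL].
have [_ [v Mv vd] _] := dP l lL; have [x [Mx xl xL]] := neg l lL.
(* The weights cancel on [l], since [dot l x < 0 < dot l c]; any other functional is nonnegative on
   [x] and positive on [c]. *)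
pose y := x *+ `|dot l c| + c *+ `|dot l x|.
have My : group_gen M y.
  by apply: group_genD; apply: group_genMn => //; exact: sub_group_gen.
have yl : dot l y = 0.
  rewrite dotDr !dotMnr; have := cL _ lL; lia.
have yL m : m \in L -> m != l -> 1 <= dot m y.
  move=> mL ml; rewrite dotDr !dotMnr; have := cL _ mL; have := xL _ mL ml.
  have : (0 < `|dot l x|)%N by rewrite absz_gt0 lt_eqF.
  nia.
(* Large enough to outweigh every negative [dot m v], as [dot m y] is at least 1 for [m != l]. *)
pose N := \sum_(m <- L) `|dot m v|%N.
exists (v + y *+ N); split.
- by apply: group_genD => //; exact: group_genMn.
- by rewrite dotDr dotMnr yl mul0rn addr0.
- move=> m mL ml; rewrite dotDr dotMnr; have := yL m mL ml.
  have : (`|dot m v| <= N)%N by rewrite /N (big_rem m)//= leq_addr.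
  nia.
Qed.

End Lattice.

(** * Passage from integral to rational points, and the facet description of [Vm] *)

Section Embedding.
Set Implicit Arguments.
Unset Strict Implicit.
Variable q : nat.
Implicit Types (M : set 'rV[int]_q) (x y l : 'rV[int]_q) (s : seq 'rV[int]_q).

Lemma dot_of_int l x :
  dot (of_int rat l) (of_int rat x) = (dot l x)%:~R.
Proof. by rewrite rmorph_sum; apply: eq_bigr => i _; rewrite !mxE rmorphM. Qed.

Lemma of_int_inj : injective (@of_int rat q).
Proof.
move=> x y /rowP xy; apply/rowP => i; have := xy i; rewrite !mxE.
exact: intr_inj.
Qed.

Lemma of_intD (K : pzRingType) x y :
  of_int K (x + y) = of_int K x + of_int K y.
Proof. exact: map_mxD. Qed.

Lemma of_intMn (K : pzRingType) x k : of_int K (x *+ k) = k%:R *: of_int K x.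
Proof. by apply/rowP => i; rewrite !mxE mulmxnE rmorphMn /= mulr_natl. Qed.

Lemma clear_denominators (x : 'rV[rat]_q) :
  exists y k, (0 < k)%N /\ k%:R *: x = of_int rat y.
Proof.
pose k := (\prod_i `|denq (x 0%R i)|)%N.
have /choice[f fP] : forall i, exists z : int, k%:R * x 0 i = z%:~R.
  move=> i; exists ((\prod_(j | j != i) `|denq (x 0%R j)|)%N%:Z * numq (x 0 i)).
  rewrite intrM numqE /k (bigD1 i)//= natrM natr_absz.
  rewrite ger0_norm ?ltW ?denq_gt0//.
  by ring.
exists (\row_i f i), k; split.
  by apply: prodn_gt0 => i; rewrite absz_gt0 denq_neq0.
by apply/rowP => i; rewrite !mxE fP.
Qed.

Lemma cone_of_smallest s x : smallest (@submonoid q) [set` s] x ->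
  cone_of (map (@of_int rat q) s) (of_int rat x).
Proof.
pose A := [set x | cone_of (map (@of_int rat q) s) (of_int rat x)].
suff H : smallest (@submonoid q) [set` s] `<=` A by apply: H.
apply: smallest_sub => [|y /= ys].
  apply/submonoidP; split=> [|y z ys zs]; rewrite /A/=.
    by rewrite /of_int map_mx0; exact: cone_of0.
  by rewrite of_intD; exact: cone_ofD.
by apply: mem_cone_of; exact: map_f.
Qed.

(** The rational coefficients have a common denominator, built up one generator at a time. *)
Lemma cone_of_multiple M s (x : 'rV[rat]_q) : submonoid M ->
  {in s, forall g, M g} -> cone_of (map (@of_int rat q) s) x ->
  exists u k, [/\ (0 < k)%N, M u & k%:R *: x = of_int rat u].
Proof.
move=> Mmon; have [M0 MD] := (submonoidP M).1 Mmon.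
elim: s x => [|g s IH] x sM /=.
  by move=> ->; exists 0, 1%N; rewrite scaler0 /of_int map_mx0.
move=> [c c0 /IH[|u [k [k0 Mu ku]]]].
  by move=> h hs; apply: sM; rewrite inE hs orbT.
exists (u *+ `|denq c| + g *+ (k * `|numq c|)), (k * `|denq c|)%N; split.
- by rewrite muln_gt0 k0 absz_gt0 denq_neq0.
- by apply: MD; apply: submonoidMn => //; apply: sM; exact: mem_head.
rewrite of_intD !of_intMn -ku scalerA scalerBr !scalerA addrAC -addrA.
rewrite -scalerBl !natrM.
have -> : (`|numq c|%N%:R : rat) = c * `|denq c|%N%:R.
  rewrite !natr_absz (ger0_norm (ltW (denq_gt0 c))) ger0_norm ?numqE//.
  by rewrite numq_ge0.
by rewrite [X in _ + X]scalerBl mulrAC; apply/rowP => i; rewrite !mxE; ring.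
Qed.

(** A positive multiple [x *+ k] lies in [M], so [x] is in the real cone as [k^-1] times a single
    element of [M], and normality applies. *)
Lemma normal_cone_of (R : realType) M s x : submonoid M ->
  {in s, forall g, M g} -> normal_monoid R M ->
  group_gen M x -> cone_of (map (@of_int rat q) s) (of_int rat x) -> M x.
Proof.
move=> Mmon sM normM Mx /(cone_of_multiple Mmon sM)[u [k [k0 Mu]]].
rewrite -of_intMn => /of_int_inj ku; rewrite -normM; split=> //.
exists 1%N, (fun=> k%:R^-1), (fun=> u); split=> //=.
rewrite big_ord1 -ku of_intMn scalerA mulVf ?scale1r//.
by rewrite pnatr_eq0 -lt0n.
Qed.

(** Weyl's theorem over the rationals; scaling each functional by a positive integer makes it
    integral without changing its halfspace. *)
Lemma integral_halfspaces (R : realType) M : affine_monoid M ->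
  normal_monoid R M -> exists2 L : seq 'rV[int]_q,
    {in L, forall l x, M x -> 0 <= dot l x} & cuts_out M L.
Proof.
move=> [Mmon [s Ms] _] normM.
have sM : {in s, forall g, M g}.
  by move=> g gs; rewrite Ms; exact: sub_gen_smallest.
have [P HP] := cone_of_halfspaces (map (@of_int rat q) s).
have /choice[f fP] := clear_denominators.
have fE p x : (0 <= dot (f p) x) = (0 <= dot p (of_int rat x)).
  have [k [k0 kE]] := fP p.
  by rewrite -(ler0z rat) -dot_of_int -kE dotZl pmulr_rge0// ltr0n.
exists (map f P) => [_ /mapP[p pP ->] x Mx|x Mx xP].
  by rewrite fE; move: p pP; apply/HP; apply: cone_of_smallest; rewrite -Ms.
apply: normal_cone_of normM Mx _ => //; first exact: sM.
by apply/HP => p pP; rewrite -fE; apply: xP; exact: map_f.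
Qed.

(* The coordinate sum is bounded, up to a constant, by the sum of the
   functionals, because only 0 is killed by all of them. *)
Lemma coord_sum_bound M (L : seq 'rV[int]_q) s :
  (forall v, M v -> forall i, 0 <= v 0 i) ->
  {in s, forall g, M g} -> {in L, forall l x, M x -> 0 <= dot l x} ->
  cuts_out M L ->
  exists K : nat, {in s, forall g,
    dot (const_mx 1) g <= K%:Z * dot (\sum_(l <- L) l) g}.
Proof.
move=> Mge0 sM LM0 LM.
(* By integrality, a positive sum of functionals is at least 1, so this constant suffices. If the
   sum is not positive, [- g] also lies in [M] and [g] is 0. *)
exists (\sum_(g <- s) `|dot (const_mx 1%R) g|)%N => g gs.
rewrite dot_suml; have Mg := sM g gs.
have [g0|gpos] := leP (\sum_(l <- L) dot l g) 0.
  have lg l : l \in L -> dot l g = 0.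
    move=> lL; apply/eqP; rewrite eq_le LM0// andbT; apply: le_trans g0.
    rewrite (big_rem l)//= lerDl big_seq; apply: sumr_ge0 => m /mem_rem mL.
    by rewrite LM0.
  have MNg : M (- g).
    apply: LM => [|l /lg]; last by rewrite dotNr => ->.
    by apply: group_genN; exact: sub_group_gen.
  suff -> : g = 0.
    by rewrite dot0r [X in _ <= _ * X]big1 ?mulr0// => l _; rewrite dot0r.
  apply/rowP => i; rewrite mxE; apply/eqP; rewrite eq_le Mge0// andbT.
  by have := Mge0 _ MNg i; rewrite mxE oppr_ge0.
have : (`|dot (const_mx 1%R) g| <= \sum_(g <- s) `|dot (const_mx 1%R) g|)%N.
  by rewrite (big_rem g)//= leq_addr.
move: (\sum_(g <- s) _)%N (\sum_(l <- L) _) gpos (dot _ g) => K S; nia.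
Qed.

Lemma VmP M (L : seq 'rV[int]_q) (d : 'rV[int]_q -> int) m a : (0 < m)%N ->
  {in L, forall l x, M x -> 0 <= dot l x} -> cuts_out M L ->
  {in L, forall l, 0 < d l} ->
  {in L, forall l x, group_gen M x -> dot l x < 0 -> dot l x <= - d l} ->
  {in L, forall l, exists w, [/\ group_gen M w, dot l w = - d l &
     {in L, forall m, m != l -> 0 <= dot m w}]} ->
  Vm m M a <-> exists u, [/\ M u, a = m%:R^-1 *: of_int rat u &
    {in L, forall l, dot l u < m%:Z * d l}].
Proof.
move=> m0 LM0 LM d0 dmin dw.
have mQ : m%:R != 0 :> rat by rewrite pnatr_eq0 -lt0n.
split=> [[[u Mu <-] Hu]|[u [Mu -> uL]]].
  exists u; split=> // l lL; rewrite ltNge; apply/negP => ul.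
  have [w [Mw wl wL]] := dw l lL.
  (* Moving by [m] times [w] lowers [l] by exactly [m * d l], which [ul] affords, and lowers no
     other functional. So [w] is a difference to which [Hu] applies, although [l] is negative on
     it. *)
  have Me : M (u + w *+ m).
    apply: LM => [|n nL].
      by apply: group_genD; [exact: sub_group_gen|exact: group_genMn].
    rewrite dotDr dotMnr; have [->|nl] := eqVneq n l.
      by rewrite wl -mulr_natl; lia.
    by rewrite addr_ge0 ?LM0// mulrn_wge0// wL.
  have [] : (of_int rat @` M) (of_int rat w).
    apply: Hu; split; last by exists w.
    exists (m%:R^-1 *: of_int rat (u + w *+ m)); first by exists (u + w *+ m).
    rewrite of_intD of_intMn scalerDr scalerA mulVf// scale1r.
    by rewrite addrAC subrr add0r.
  move=> w' Mw' /of_int_inj ww'; have := LM0 l lL w' Mw'; rewrite ww' wl.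
  by have := d0 l lL; lia.
split; first by exists u.
(* Here [e = u + w *+ m]; a negative [dot l w] would be at most [- d l] and force [dot l e < 0]. *)
move=> _ [[_ [e Me <-] <-] [w Mw ew]]; exists w => //.
have {}ew : e = u + w *+ m.
  apply: of_int_inj; rewrite of_intD of_intMn ew scalerBr !scalerA mulfV//.
  by rewrite !scale1r addrC subrK.
apply: LM => // l lL; rewrite leNgt; apply/negP => wl.
have := dmin l lL w Mw wl; have := uL l lL; have := LM0 l lL e Me.
by rewrite ew dotDr dotMnr -mulr_natl; nia.
Qed.

End Embedding.

(** * The threshold as the optimal value of a rational linear program *)

Lemma coord_sumE q (a : 'rV[rat]_q) : coord_sum a = dot (const_mx 1) a.
Proof. by apply: eq_bigr => i _; rewrite mxE mul1r. Qed.

Lemma dot_const1_of_int q (x : 'rV[int]_q) :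
  dot (const_mx 1) (of_int rat x) = (dot (const_mx 1) x)%:~R.
Proof. by rewrite -dot_of_int; congr dot; apply/rowP => i; rewrite !mxE. Qed.

(** The value [r] may fail to lie in [A]. If the supremum were a real number below [r], a rational
    [t] strictly between them would be [(t / r) * r], hence in [A]. *)
Lemma ereal_sup_ratr (R : realType) (A : set rat) (r : rat) : 0 < r ->
  (forall t, A t -> t <= r) ->
  (forall c, 0 <= c -> c < 1 -> A (c * r)) ->
  ereal_sup [set (ratr t : R)%:E | t in A] = (ratr r : R)%:E.
Proof.
move=> r0 Ar Acr; apply/eqP; rewrite eq_le; apply/andP; split.
  by apply: ge_ereal_sup => _ [t At <-]; rewrite lee_fin ler_rat Ar.
have ubA c : 0 <= c -> c < 1 ->
    ((ratr (c * r) : R)%:E <= ereal_sup [set (ratr t : R)%:E | t in A])%E.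
  by move=> c0 c1; apply: ereal_sup_ubound; exists (c * r) => //; exact: Acr.
rewrite leNgt; apply/negP; move: ubA; case: ereal_sup => [y||] ubA.
- rewrite lte_fin => yr.
  have y0 : 0 <= y by have := ubA 0 (lexx _) ltr01; rewrite mul0r rmorph0.
  have [t] := rat_in_itvoo yr; rewrite in_itv/= => /andP[yt tr].
  have t0 : 0 <= t by rewrite -(ler_rat R) rmorph0 (le_trans y0)// ltW.
  have tr0 : 0 <= t / r by rewrite divr_ge0// ltW.
  have tr1 : t / r < 1 by rewrite ltr_pdivrMr// mul1r -(ltr_rat R).
  have := ubA _ tr0 tr1; rewrite divfK ?gt_eqF// lee_fin.
  by rewrite leNgt yt.
- by rewrite ltNge leey.
- by have := ubA 0 (lexx _) ltr01; rewrite mul0r rmorph0.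
Qed.

(** The zero monoid is excluded because its threshold is 0, which is not positive. *)
Theorem proposition4p4 (R : realType) (q : nat) (M : set 'rV[int]_q)
    (q_gt0 : (0 < q)%N) (affM : affine_monoid M) (M_neq0 : M <> [set 0])
    (normM : normal_monoid R M) :
  exists2 r : rat, 0 < r & mpt R M = (ratr r : R)%:E.
Proof.
have [L0 L0M L0cut] := integral_halfspaces affM normM.
have [Mmon [s Ms] Mge0] := affM.
have [L [d [LM0 LM d0 dmin dw]]] := facet_functionals Mmon L0M L0cut.
have sM : {in s, forall g, M g}.
  by move=> g gs; rewrite Ms; exact: sub_gen_smallest.
have Mcone x : M x -> cone_of (map (@of_int rat q) s) (of_int rat x).
  by rewrite Ms; exact: cone_of_smallest.
have {dmin dw} VmE m a m0 :=
  @VmP q M L d m a m0 LM0 LM d0 dmin dw.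
have d1 l : l \in L -> 1 <= (d l)%:~R :> rat by move=> /d0; rewrite ler1z.
have [K HK] := coord_sum_bound Mge0 sM LM0 LM.
have [||x [xs xL xmax]] := @linear_program_max rat q (map (@of_int rat q) s)
    _ L (const_mx 1) (@of_int rat q) (fun l => (d l)%:~R)
    (K%:R * \sum_(l <- L) (d l)%:~R).
- by move=> l /d1; apply: le_trans.
- move=> x xs xL.
  (* The bound of [HK] on generators extends to the rational cone by linearity. *)
  apply: (@le_trans _ _ (K%:R * \sum_(l <- L) dot (of_int rat l) x));
    last first.
    by rewrite ler_wpM2l// big_seq [leRHS]big_seq; exact: ler_sum.
  rewrite -dot_suml -dotZl -subr_ge0 -dotNl -dotDl.
  apply: cone_of_ge0 xs => _ /mapP[g gs ->].
  rewrite dotDl dotNl dotZl subr_ge0 dot_const1_of_int dot_suml.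
  under eq_bigr do rewrite dot_of_int.
  rewrite -rmorph_sum/= -dot_suml.
  have -> : (K%:R : rat) = K%:Z%:~R by [].
  by rewrite -intrM ler_int HK.
set r := dot (const_mx 1) x in xmax.
have r0 : 0 < r.
  have [g Mg g0] : exists2 g, M g & 0 < dot (const_mx 1) g.
    apply: contrapT => H; apply: M_neq0; apply/seteqP; split=> [y My|_ ->].
      have y0 : dot (const_mx 1) y = 0.
        apply/eqP; rewrite eq_le; apply/andP; split.
          by rewrite leNgt; apply/negP => y0; apply: H; exists y.
        by apply: sumr_ge0 => i _; rewrite mxE mul1r Mge0.
      apply/rowP => i; rewrite mxE; apply/eqP; rewrite eq_le Mge0// andbT -y0.
      rewrite /dot (bigD1 i)//= mxE mul1r lerDl; apply: sumr_ge0 => j _.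
      by rewrite mxE mul1r Mge0.
    by have [] := (submonoidP M).1 Mmon.
  (* Since every [d l] is at least 1, dividing [g] by [N] makes it feasible, with positive
     coordinate sum. *)
  pose N := (1 + \sum_(l <- L) `|dot l g|)%N.
  have N0 : 0 < N%:R :> rat by rewrite ltr0n.
  apply: lt_le_trans (xmax (N%:R^-1 *: of_int rat g) _ _).
  - by rewrite dotZr dot_const1_of_int mulr_gt0 ?invr_gt0// ltr0z.
  - by apply: cone_ofZ; [rewrite invr_ge0 ler0n|exact: Mcone].
  - move=> l lL; apply: le_trans (d1 l lL).
    rewrite dotZr dot_of_int mulrC ler_pdivrMr// mul1r.
    have -> : (N%:R : rat) = N%:Z%:~R by [].
    rewrite ler_int /N (big_rem l)//=; lia.
exists r => //; rewrite -(@ereal_sup_ratr R (@coord_sum q @` Vset M))//.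
- by rewrite /mpt image_comp.
- move=> _ [a [m m1 +] <-]; move/VmE => /(_ (ltnW m1))[u [Mu -> uL]].
  have m0 : 0 < m%:R :> rat by rewrite ltr0n ltnW.
  rewrite coord_sumE; apply: xmax => [|l lL].
    by apply: cone_ofZ; [rewrite invr_ge0 ltW|exact: Mcone].
  rewrite dotZr dot_of_int mulrC ler_pdivrMr// mulrC.
  have -> : (m%:R : rat) = m%:Z%:~R by [].
  by rewrite -intrM ler_int ltW// uL.
move=> c c0 c1; have [u [k [k0 Mu ku]]] :
    exists u k, [/\ (0 < k)%N, M u & k%:R *: (c *: x) = of_int rat u].
  by apply: (cone_of_multiple Mmon sM); exact: cone_ofZ.
exists (c *: x); last by rewrite coord_sumE dotZr.
(* The denominator [k] may be 1, while [Vset] requires an index above 1; doubling [u] and [k] leaves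
   the point unchanged. *)
have k2 : (1 < k * 2)%N by lia.
exists (k * 2)%N => //; apply/VmE; first exact: ltnW.
exists (u *+ 2); split; first exact: submonoidMn.
  rewrite of_intMn -ku !scalerA natrM.
  by rewrite -[c in LHS]mul1r; congr (_ *: _); field; rewrite pnatr_eq0; lia.
move=> l lL; rewrite dotMnr PoszM -mulrA [2%:Z * _]mulrC mulrA -mulr_natr.
rewrite ltr_pM2r// -(ltr_int rat) -dot_of_int -ku !dotZr intrM.
rewrite ltr_pM2l ?ltr0n//.
(* Strictness comes from [c < 1] together with [0 < d l]. *)
apply: le_lt_trans (ler_wpM2l c0 (xL l lL)) _.
by rewrite gtr_pMl// (lt_le_trans ltr01)// d1.
Qed.
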